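(* Let $\mathfrak Q=(\mathfrak Q,\ast)$ be a quantale with top element $\top$, let $\gamma\in\mathfrak Q\setminus\{\top\}$, and let $\overline{\mathfrak Q}^\gamma=\mathfrak Q\cup\{\overline\top,e\}$ be the extension of the underlying complete lattice of $\mathfrak Q$ by an isolated element $e$ with $e^-=\gamma$ and $e^+=\overline\top$. Then there exists a unique quantale structure on the complete lattice $\overline{\mathfrak Q}^\gamma$ with unit $e$ and with $\mathfrak Q$ as a subquantale if and only if the following two conditions hold for all $\alpha\in\mathfrak Q$ and all $\beta\in\mathfrak Q$ with $\beta\not\le\gamma$: (A) $(\gamma\ast\alpha)\vee(\alpha\ast\gamma)\le\alpha$; (B) $\top\ast\alpha\le(\beta\ast\alpha)\vee\alpha$ and $\alpha\ast\top\le(\alpha\ast\beta)\vee\alpha$. Moreover, if (A) and (B) hold and there exist two elements $\alpha,\beta\in\mathfrak Q$ with $\gamma\wedge(\alpha\vee\beta)\not\le(\gamma\wedge\alpha)\vee(\gamma\wedge\beta)$, then $\overline{\mathfrak Q}^\gamma$ (with this quantale structure) is a unitally nondistributive quantale.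
   Context: A quantale is a complete lattice with an associative binary operation $\ast$ preserving arbitrary joins in each variable separately. It is unital if $\ast$ has a two-sided unit. A subquantale of a quantale is a subset closed under arbitrary joins and under $\ast$; that $\mathfrak Q$ is a subquantale of $\overline{\mathfrak Q}^\gamma$ means that the multiplication of $\overline{\mathfrak Q}^\gamma$ restricts to the given multiplication of $\mathfrak Q$. The extension $\overline{L}^\gamma$: for a complete lattice $L$, $\gamma\in L$, and two distinct new elements $\overline\top,e\notin L$, the complete lattice $\overline L^\gamma=L\cup\{\overline\top,e\}$ has the order extending that of $L$ in which $\overline\top$ is the top element and, for $\alpha\in L$: $\alpha\le e$ if $\alpha\le\gamma$ in $L$, and $\alpha$ and $e$ are incomparable if $\alpha\not\le\gamma$ in $L$. (Thus the elements strictly below $e$ are exactly those $\le\gamma=:e^-$, and the only element strictly above $e$ is $\overline\top=:e^+$, except that for the order on $L$ nothing changes.) Totally below relation on a complete lattice $L$: $\beta\vartriangleleft\alpha$ if for every $A\subseteq L$ with $\alpha\le\bigvee A$ there is $\gamma\in A$ with $\beta\le\gamma$. A unital quantale $(\mathfrak Q,\ast,e)$ is unitally nondistributive if (1) $\bigvee\{\alpha\in\mathfrak Q\mid\alpha\vartriangleleft e\}=e$ and (2) there is a subset $A\subseteq\mathfrak Q$ with $e\wedge(\bigvee A)\not\le\bigvee_{\alpha\in A}(e\wedge\alpha)$. *)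

(* Defs.v *)
From HB Require Import structures.
From mathcomp Require Import all_boot all_order.
From mathcomp Require Import boolp classical_sets.

Set Implicit Arguments.
Unset Strict Implicit.
Unset Printing Implicit Defensive.

Import Order.TTheory.

Local Open Scope classical_set_scope.
Local Open Scope order_scope.

HB.mixin Record hasAllSups d T of Order.POrder d T := {
  bigsup : set T -> T;
  bigsupP : forall A : set T, supremums A (bigsup A)
}.

#[short(type="completeLatticeType")]
HB.structure Definition CompleteLattice d :=
  { T of Order.TBLattice d T & hasAllSups d T }.

(* Any poset with all suprema (that of [set0] included) is a complete lattice:
   meets are suprema of sets of lower bounds. *)
HB.factory Record POrder_isComplete d T of Order.POrder d T := {
  bigsup : set T -> T;
  bigsupP : forall A : set T, supremums A (bigsup A)
}.

HB.builders Context d T of POrder_isComplete d T.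

Let meet (x y : T) := bigsup [set z | z <= x /\ z <= y].
Let join (x y : T) := bigsup [set z | z = x \/ z = y].

Fact lexI_subproof x y z : (x <= meet y z) = (x <= y) && (x <= z).
Proof.
have [ub lub] := bigsupP [set t | t <= y /\ t <= z].
apply/idP/andP => [le_x|[xy xz]]; last exact: ub.
by split; apply: (le_trans le_x); apply: lub => t [].
Qed.

Fact leUx_subproof x y z : (join x y <= z) = (x <= z) && (y <= z).
Proof.
have [ub lub] := bigsupP [set t | t = x \/ t = y].
apply/idP/andP => [le_z|[xz yz]]; last by apply: lub => t [] ->.
by split; apply: le_trans le_z; apply: ub; [left | right].
Qed.

HB.instance Definition _ :=
  Order.POrder_MeetJoin_isLattice.Build d T lexI_subproof leUx_subproof.

Fact le0x_subproof x : bigsup set0 <= x.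
Proof. by have [_ lub] := bigsupP set0; apply: lub. Qed.

Fact lex1_subproof x : x <= bigsup setT.
Proof. by have [ub _] := bigsupP setT; apply: ub. Qed.

HB.instance Definition _ := Order.hasBottom.Build d T le0x_subproof.
HB.instance Definition _ := Order.hasTop.Build d T lex1_subproof.
HB.instance Definition _ := hasAllSups.Build d T bigsupP.

HB.end.

Section Quantales.
Context {d : Order.disp_t} {L : completeLatticeType d}.
Implicit Types (op : L -> L -> L) (e : L) (A : set L).

Definition is_quantale op : Prop :=
  [/\ associative op,
      forall A x, op (bigsup A) x = bigsup [set op a x | a in A]
    & forall x A, op x (bigsup A) = bigsup [set op x a | a in A]].

Definition is_unital_quantale op e : Prop :=
  [/\ is_quantale op, left_id e op & right_id e op].

Definition is_subquantale op (S : set L) : Prop :=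
  (forall A, A `<=` S -> S (bigsup A)) /\
  (forall x y, S x -> S y -> S (op x y)).

Definition totally_below (b a : L) : Prop :=
  forall A, a <= bigsup A -> exists2 c, A c & b <= c.

Definition unitally_nondistributive op e : Prop :=
  [/\ is_unital_quantale op e,
      bigsup [set a | totally_below a e] = e
    & exists A, ~~ (Order.meet e (bigsup A)
                      <= bigsup [set Order.meet e a | a in A])].

End Quantales.

Inductive isolated_ext (d : Order.disp_t) (L : completeLatticeType d) (g : L) :=
  | Old of L
  | NewTop
  | NewUnit.

Arguments Old {d L g}.
Arguments NewTop {d L g}.
Arguments NewUnit {d L g}.

Section IsolatedExt.
Context {d : Order.disp_t} {L : completeLatticeType d} {g : L}.
Local Notation ext := (isolated_ext g).

Let encode (x : ext) : option (option L) :=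
  match x with Old a => Some (Some a) | NewTop => Some None | NewUnit => None end.
Let decode (x : option (option L)) : ext :=
  match x with Some (Some a) => Old a | Some None => NewTop | None => NewUnit end.

Fact encodeK : cancel encode decode. Proof. by case. Qed.

HB.instance Definition _ := Choice.copy ext (can_type encodeK).

Definition ext_le (x y : ext) : bool :=
  match x, y with
  | _, NewTop => true
  | NewTop, _ => false
  | Old a, Old b => a <= b
  | Old a, NewUnit => a <= g
  | NewUnit, Old _ => false
  | NewUnit, NewUnit => true
  end.

Fact ext_le_refl : reflexive ext_le.
Proof. by case=> [a||] /=. Qed.

Fact ext_le_anti : antisymmetric ext_le.
Proof.
case=> [a||] [b||] //=; rewrite ?andbF //.
by move=> /le_anti ->.
Qed.

Fact ext_le_trans : transitive ext_le.
Proof. by case=> [b||] [a||] [c||] //=; apply: le_trans. Qed.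

HB.instance Definition _ :=
  Order.Le_isPOrder.Build d ext ext_le_refl ext_le_anti ext_le_trans.

Definition ext_sup (A : set ext) : ext :=
  let s := bigsup [set a | A (Old a)] in
  if `[< A NewTop >] then NewTop
  else if `[< A NewUnit >] then (if s <= g then NewUnit else NewTop)
  else Old s.

Fact ext_supP (A : set ext) : supremums A (ext_sup A).
Proof.
rewrite /ext_sup; set s := bigsup _.
have [ub lub] : supremums [set a | A (Old a)] s := bigsupP _.
case: asboolP => [At|nAt].
  by split=> [|y]; [case | apply].
case: asboolP => [Au|nAu]; last first.
  split=> [[a||] // Aa|[b||] ub_b //]; first exact: ub.
  - by apply: lub => a Aa; apply: (ub_b (Old a)).
  - by apply: lub => a Aa; apply: (ub_b (Old a)).
case: ifPn => sg; split.
- by case=> [a||] // Aa; apply: le_trans sg; apply: ub.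
- by move=> y; apply.
- by case.
- case=> [b||] ub_b //; first by have := ub_b NewUnit Au.
  by case/negP: sg; apply: lub => a Aa; apply: (ub_b (Old a)).
Qed.

HB.instance Definition _ := POrder_isComplete.Build d ext ext_supP.

End IsolatedExt.

Definition is_unital_extension (d : Order.disp_t) (Q : completeLatticeType d)
    (op : Q -> Q -> Q) (g : Q)
    (op' : isolated_ext g -> isolated_ext g -> isolated_ext g) : Prop :=
  [/\ is_unital_quantale op' NewUnit,
      is_subquantale op' (range Old)
    & forall x y : Q, op' (Old x) (Old y) = Old (op x y)].

Section Conditions.
Context {d : Order.disp_t} {Q : completeLatticeType d}.
Variables (op : Q -> Q -> Q) (g : Q).

Definition conditionA : Prop :=
  forall a : Q, Order.join (op g a) (op a g) <= a.

Definition conditionB : Prop :=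
  forall a b : Q, ~~ (b <= g) ->
    op \top a <= Order.join (op b a) a /\ op a \top <= Order.join (op a b) a.

End Conditions.

(* Main.v *)
(** The unit law forces the value of the product everywhere except at the new
    top, and since the new top is the join of [e] with any element of [Q] not
    below [g] (in particular with the top of [Q]), join preservation forces
    [NewTop * a = a \/ top * a] as well: this gives uniqueness.  Condition (A)
    is monotonicity at [g <= e], and (B) says that [b \/ e = NewTop] is
    respected for each [b] not below [g].  Conversely, these are the only
    joins involving [e] that are not trivial, so (A) and (B) are enough for
    the forced product to preserve all joins. *)
Require Import Defs.
From mathcomp Require Import all_boot all_order.
From mathcomp Require Import boolp classical_sets.
Import Order.TTheory.
Local Open Scope classical_set_scope.
Local Open Scope order_scope.

Set Implicit Arguments.
Unset Strict Implicit.
Unset Printing Implicit Defensive.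

(** * Suprema and the maps that preserve them *)

Section BigSup.
Context {d : Order.disp_t} {L : completeLatticeType d}.
Implicit Types (A B : set L) (x y : L).

Lemma bigsup_ub A x : A x -> x <= bigsup A.
Proof. by have [ub _] := bigsupP A; apply: ub. Qed.

Lemma bigsup_lub A y : (forall x, A x -> x <= y) -> bigsup A <= y.
Proof. by have [_ lub] := bigsupP A; apply: lub. Qed.

Lemma bigsup_pair x y : bigsup [set x; y] = Order.join x y.
Proof.
apply/le_anti/andP; split.
  by apply: bigsup_lub => z [] ->; rewrite ?leUl ?leUr.
by rewrite leUx !bigsup_ub //; [right | left].
Qed.

End BigSup.

(** Source and target may differ, so that this covers the embedding [Old] as well as the
    translations of a quantale. *)
Definition preserves_sups d (L : completeLatticeType d) d'
    (M : completeLatticeType d') (f : L -> M) : Prop :=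
  forall A, f (bigsup A) = bigsup [set f a | a in A].

Section PreservesSups.
Context {d d' : Order.disp_t}.
Context {L : completeLatticeType d} {M : completeLatticeType d'}.
Variable f : L -> M.

Lemma preserves_sups_leP : {homo f : x y / x <= y} ->
  (forall A, f (bigsup A) <= bigsup [set f a | a in A]) -> preserves_sups f.
Proof.
move=> f_homo f_le A; apply/le_anti; rewrite f_le /=.
by apply: bigsup_lub => _ [a Aa <-]; apply/f_homo/bigsup_ub.
Qed.

Hypothesis f_sups : preserves_sups f.

Lemma preserves_supsU : {morph f : x y / Order.join x y}.
Proof. by move=> x y; rewrite -!bigsup_pair f_sups image_setU !image_set1. Qed.

Lemma preserves_sups_homo : {homo f : x y / x <= y}.
Proof. by move=> x y /join_idPl xy; rewrite -xy preserves_supsU leUr. Qed.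

End PreservesSups.

Lemma preserves_sups_id d (L : completeLatticeType d) :
  preserves_sups (@id L).
Proof. by move=> A; rewrite /= image_id. Qed.

Lemma preserves_sups_comp d (L : completeLatticeType d)
    d' (M : completeLatticeType d') d'' (N : completeLatticeType d'')
    (f : M -> N) (h : L -> M) :
  preserves_sups f -> preserves_sups h -> preserves_sups (f \o h).
Proof. by move=> f_sups h_sups A; rewrite [LHS]/= h_sups f_sups image_comp. Qed.

Lemma preserves_sups_join d (L : completeLatticeType d)
    d' (M : completeLatticeType d') (f h : L -> M) :
  preserves_sups f -> preserves_sups h ->
  preserves_sups (fun x => Order.join (f x) (h x)).
Proof.
move=> f_sups h_sups; apply: preserves_sups_leP => [x y xy|A].
  by apply: leU2; apply: preserves_sups_homo.
have fh_ub a : A a ->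
    Order.join (f a) (h a) <= bigsup [set Order.join (f x) (h x) | x in A].
  by move=> Aa; apply: bigsup_ub; exists a.
rewrite f_sups h_sups leUx; apply/andP.
by split; apply: bigsup_lub => _ [a /fh_ub + <-]; rewrite leUx => /andP[].
Qed.

(** * The lattice extended by an isolated element *)

Section ExtLattice.
Context {d : Order.disp_t} {L : completeLatticeType d} {g : L}.
Local Notation ext := (isolated_ext g).
Implicit Types (x y : ext) (a b : L) (A : set ext).

Lemma ext_leE x y : (x <= y) = ext_le x y.
Proof. by []. Qed.

Lemma bigsup_extE A : bigsup A = ext_sup A.
Proof. by []. Qed.

Lemma bigsup_range_Old A : A `<=` range Old ->
  bigsup A = Old (bigsup [set a | A (Old a)]).
Proof.
move=> AO; rewrite bigsup_extE /ext_sup.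
by case: asboolP => [/AO [] //|_]; case: asboolP => [/AO [] //|_].
Qed.

Lemma preserves_sups_Old : preserves_sups (Old : L -> ext).
Proof.
move=> B; rewrite bigsup_range_Old; last by move=> _ [a _ <-]; exists a.
congr (Old (bigsup _)); apply/seteqP; split=> a; last by case=> b Bb [<-].
by move=> Ba; exists a.
Qed.

Lemma joinOld a b : Order.join (Old a : ext) (Old b) = Old (Order.join a b).
Proof. by rewrite (preserves_supsU preserves_sups_Old). Qed.

Lemma joinUnitOld b : ~~ (b <= g) -> Order.join (NewUnit : ext) (Old b) = NewTop.
Proof.
move=> nbg; have := leUl (NewUnit : ext) (Old b).
have := leUr (Old b : ext) NewUnit.
by case: (Order.join _ _) => // + _; rewrite ext_leE /= (negPf nbg).
Qed.

Lemma meetUnitOld a : Order.meet (NewUnit : ext) (Old a) = Old (Order.meet g a).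
Proof.
apply/le_anti/andP; split; last first.
  by rewrite lexI; apply/andP; split; [exact: leIl | exact: leIr].
have := leIl (NewUnit : ext) (Old a); have := leIr (Old a : ext) NewUnit.
by case: (Order.meet _ _) => // c; rewrite !ext_leE /= lexI => -> ->.
Qed.

(** A supremum of old elements is old and no old element is above [NewUnit], so a family whose
    supremum reaches [NewUnit] contains [NewUnit] or [NewTop]. *)
Lemma totally_below_unit : totally_below (NewUnit : ext) NewUnit.
Proof.
move=> A; rewrite bigsup_extE /ext_sup.
case: asboolP => [At _|_]; first by exists NewTop.
by case: asboolP => [Au _|//]; exists NewUnit.
Qed.

Lemma bigsup_totally_below_unit :
  bigsup [set x : ext | totally_below x NewUnit] = NewUnit.
Proof.
apply/le_anti/andP; split; last exact/bigsup_ub/totally_below_unit.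
(* Testing against the singleton of the unit shows that whatever is totally below the unit is below
   it. *)
apply: bigsup_lub => x /(_ [set NewUnit])[|_ -> //].
exact: bigsup_ub.
Qed.

(** The first three inequalities extend monotonicity from the old elements to the new ones. A
    supremum in [ext] is a member of the family or the supremum of its old part, except when
    [NewUnit] meets an old part not below [g] and the supremum jumps to [NewTop]; the last
    hypothesis handles that jump. *)
Lemma ext_preserves_sups d' (M : completeLatticeType d') (f : ext -> M) :
    preserves_sups (f \o Old) ->
    f (Old g) <= f NewUnit -> f NewUnit <= f NewTop -> f (Old \top) <= f NewTop ->
    (forall b, ~~ (b <= g) -> f NewTop <= Order.join (f NewUnit) (f (Old b))) ->
  preserves_sups f.
Proof.
move=> fO fgu fut fOt ft; have fO_homo := preserves_sups_homo fO.
apply: preserves_sups_leP => [|A].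
  case=> [a||] [b||] //= ab; first exact: fO_homo.
    exact: le_trans (fO_homo _ _ (lex1 a)) fOt.
  exact: le_trans (fO_homo _ _ ab) fgu.
have f_ub x : A x -> f x <= bigsup [set f a | a in A].
  by move=> Ax; apply: bigsup_ub; exists x.
have f_Old : f (Old (bigsup [set a | A (Old a)])) <= bigsup [set f a | a in A].
  rewrite -[f (Old _)]/((f \o Old) _) fO; apply: bigsup_lub => _ [a Aa <-].
  exact: f_ub.
rewrite bigsup_extE /ext_sup; case: asboolP => [/f_ub //|_].
case: asboolP => [/f_ub fu|//]; case: ifPn => [//|/ft].
by move/le_trans; apply; rewrite leUx fu.
Qed.

End ExtLattice.

(** * The forced product, and sufficiency of the two conditions *)

Section ExtOp.
Context {d : Order.disp_t} {Q : completeLatticeType d}.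
Variable g : Q.
Implicit Type op : Q -> Q -> Q.
Local Notation ext := (isolated_ext g).

Definition ext_op op (x y : ext) : ext :=
  match x, y with
  | NewUnit, _ => y
  | _, NewUnit => x
  | NewTop, NewTop => NewTop
  | NewTop, Old b => Old (Order.join b (op \top b))
  | Old a, NewTop => Old (Order.join a (op a \top))
  | Old a, Old b => Old (op a b)
  end.

(** The construction commutes with reversing the multiplication, as do the hypotheses on [op]; hence
    join preservation has to be checked in the left variable only. *)
Lemma ext_op_flip op (x y : ext) : ext_op (fun a b => op b a) x y = ext_op op y x.
Proof. by case: x y => [a||] [b||]. Qed.

Lemma is_quantale_flip op : is_quantale op -> is_quantale (fun a b => op b a).
Proof. by case=> opA opl opr; split=> // x y z; rewrite opA. Qed.

Lemma conditionA_flip op : conditionA op g -> conditionA (fun a b => op b a) g.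
Proof. by move=> cA a; rewrite joinC. Qed.

Lemma conditionB_flip op : conditionB op g -> conditionB (fun a b => op b a) g.
Proof. by move=> cB a b /(cB a)[]. Qed.

Lemma ext_opA op : is_quantale op -> associative (ext_op op).
Proof.
case=> opA opl opr.
have opUl z : {morph op^~ z : x y / Order.join x y}.
  by apply: preserves_supsU => A; apply: opl.
have opUr z : {morph op z : x y / Order.join x y}.
  by apply: preserves_supsU => A; apply: opr.
(* Absorption coming from [\top * \top <= \top]: it removes the extra term produced by two factors
   [NewTop]. *)
have topU b : Order.join (op \top b) (op (op \top \top) b) = op \top b.
  by rewrite -opUl join_l ?lex1.
have topUr b : Order.join (op b \top) (op b (op \top \top)) = op b \top.
  by rewrite -opUr join_l ?lex1.
case=> [a||] [b||] [c||] //=; congr Old; rewrite ?opUl ?opUr ?opA //.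
- by rewrite -opA topUr -joinA joinxx.
- by rewrite joinACA.
- by rewrite topU -joinA joinxx.
Qed.

(** For an old right factor, (A) supplies the inequality between [g] and the unit in
    [ext_preserves_sups], and (B) the one for the jump to [NewTop]. *)
Lemma ext_op_supsl op : is_quantale op -> conditionA op g -> conditionB op g ->
  forall y, preserves_sups ((ext_op op)^~ y).
Proof.
move=> [opA opl opr] cA cB [z||].
- apply: ext_preserves_sups => /=.
  + exact: preserves_sups_comp preserves_sups_Old (opl^~ z).
  + by have := cA z; rewrite leUx => /andP[].
  + exact: leUl.
  + exact: leUr.
  + move=> b /(cB z)[h _]; rewrite joinOld.
    by rewrite ext_leE /= leUx leUl joinC.
(* Multiplying by [NewTop] sends both new elements to [NewTop], so the content lies in the old part
   [a \/ a * \top]. *)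
- apply: ext_preserves_sups => //=.
  + apply: (preserves_sups_comp preserves_sups_Old).
    exact: preserves_sups_join (@preserves_sups_id _ _) (opl^~ \top).
  + by move=> b _; apply: leUl.
- suff -> : (ext_op op)^~ NewUnit = id by apply: preserves_sups_id.
  by apply/funext; case.
Qed.

Lemma ext_op_unital_extension op :
  is_quantale op -> conditionA op g -> conditionB op g ->
  is_unital_extension op (ext_op op).
Proof.
move=> hop cA cB; split=> //; last first.
  split=> [A AO|_ _ [a _ <-] [b _ <-]]; last by exists (op a b).
  by rewrite bigsup_range_Old //; eexists.
split; [split | by case | by case].
- exact: ext_opA.
- by move=> A y; apply: ext_op_supsl.
- move=> y A; rewrite -ext_op_flip.
  rewrite [LHS](ext_op_supsl (is_quantale_flip hop) (conditionA_flip cA)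
    (conditionB_flip cB)).
  by congr bigsup; apply: eq_imagel => x _; rewrite ext_op_flip.
Qed.

(** * Necessity of the two conditions, and uniqueness *)

Section Necessity.
Variables (op : Q -> Q -> Q) (op' : ext -> ext -> ext).
Hypothesis hop' : is_unital_extension op op'.

Let op'l y : preserves_sups (op'^~ y).
Proof. by case: hop' => [[[_ + _] _ _]] _ _ A; apply. Qed.

Let op'r x : preserves_sups (op' x).
Proof. by case: hop' => [[[_ _ +] _ _]] _ _; apply. Qed.

Lemma unital_extension_topl b y : ~~ (b <= g) ->
  op' NewTop y = Order.join y (op' (Old b) y).
Proof.
case: hop' => [[_ op'1 _] _ _] /joinUnitOld <-.
by rewrite (preserves_supsU (op'l y)) op'1.
Qed.

Lemma unital_extension_topr b x : ~~ (b <= g) ->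
  op' x NewTop = Order.join x (op' x (Old b)).
Proof.
case: hop' => [[_ _ op'1] _ _] /joinUnitOld <-.
by rewrite (preserves_supsU (op'r x)) op'1.
Qed.

Lemma unital_extension_conditionA : conditionA op g.
Proof.
case: hop' => [[_ op1l op1r] _ opO] a; rewrite leUx; apply/andP; split.
- have /(preserves_sups_homo (op'l (Old a))) : (Old g : ext) <= NewUnit.
    exact: lexx g.
  by rewrite op1l opO.
- have /(preserves_sups_homo (op'r (Old a))) : (Old g : ext) <= NewUnit.
    exact: lexx g.
  by rewrite op1r opO.
Qed.

(** If [b] is not below [g], neither is [\top], so [NewTop] is the join of the unit with either one.
    Computing its product with [a] both ways gives [a \/ \top * a = a \/ b * a], and likewise on the
    other side. *)
Lemma unital_extension_conditionB : conditionB op g.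
Proof.
case: hop' => [_ _ opO] a b bg.
have tg : ~~ (\top <= g) by apply: contra bg; apply: le_trans; apply: lex1.
split.
- have := unital_extension_topl (Old a) bg.
  rewrite (unital_extension_topl _ tg) !opO !joinOld => -[eq_top].
  by rewrite [leRHS]joinC -eq_top leUr.
- have := unital_extension_topr (Old a) bg.
  rewrite (unital_extension_topr _ tg) !opO !joinOld => -[eq_top].
  by rewrite [leRHS]joinC -eq_top leUr.
Qed.

Lemma unital_extension_ext_op : g <> \top -> op' = ext_op op.
Proof.
move=> gT; have tg : ~~ (\top <= g) by apply/negP; rewrite le1x => /eqP.
case: hop' => [[_ op1l op1r] _ opO].
apply/funext => x; apply/funext => y; case: x y => [a||] [b||] //=.
- by rewrite (unital_extension_topr _ tg) opO joinOld.
- by rewrite (unital_extension_topl _ tg) opO joinOld.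
(* The square of [NewTop] is a join having [NewTop] itself as a term, hence is [NewTop]. *)
- by rewrite (unital_extension_topl _ tg) join_l //; case: (op' _ _).
Qed.

End Necessity.
End ExtOp.

(** On old elements, meeting with the unit amounts to meeting with [g], and [Old] preserves binary
    joins, so the failure of distributivity at [g] carries over to the unit. *)
Lemma unit_nondistributive d (Q : completeLatticeType d) (g a b : Q) :
  ~~ (Order.meet g (Order.join a b)
        <= Order.join (Order.meet g a) (Order.meet g b)) ->
  exists A : set (isolated_ext g),
    ~~ (Order.meet NewUnit (bigsup A)
          <= bigsup [set Order.meet NewUnit x | x in A]).
Proof.
move=> nd; exists [set Old a; Old b].
by rewrite image_setU !image_set1 !bigsup_pair joinOld !meetUnitOld joinOld.
Qed.

Theorem theorem3p3 (d : Order.disp_t) (Q : completeLatticeType d)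
    (op : Q -> Q -> Q) (hop : is_quantale op) (g : Q) (hg : g <> \top) :
  ((exists! op' : isolated_ext g -> isolated_ext g -> isolated_ext g,
      is_unital_extension op op')
   <-> conditionA op g /\ conditionB op g)
  /\
  (conditionA op g -> conditionB op g ->
   (exists a b : Q,
      ~~ (Order.meet g (Order.join a b)
            <= Order.join (Order.meet g a) (Order.meet g b))) ->
   forall op' : isolated_ext g -> isolated_ext g -> isolated_ext g,
     is_unital_extension op op' ->
     unitally_nondistributive op' NewUnit).
Proof.
split; first split=> [[op' [hop' _]]|[cA cB]].
- by split; [apply: unital_extension_conditionA hop'
            |apply: unital_extension_conditionB hop'].
- exists (ext_op op); split; first exact: ext_op_unital_extension.
  by move=> op' /unital_extension_ext_op ->.
- move=> _ _ [a [b nd]] op' [hop' _ _]; split=> //.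
    exact: bigsup_totally_below_unit.
  exact: unit_nondistributive nd.
Qed.
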